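(* Let $\phi:(\mathfrak{g},\{\cdot,\cdot\})\to\mathfrak{X}(M)$ be an action of a post-Lie algebra $(\mathfrak{g},[\cdot,\cdot]_{\mathfrak{g}},\rhd)$ on a manifold $M$. On the trivial bundle $A=M\times\mathfrak{g}$, extend $[\cdot,\cdot]_{\mathfrak{g}}$ $C^\infty(M)$-bilinearly to $\Gamma(A)=C^\infty(M)\otimes\mathfrak{g}$ and define the anchor $a_A:M\times\mathfrak{g}\to TM$ and the bilinear operation $\rhd_A$ on $C^\infty(M)\otimes\mathfrak{g}$ by $$a_A(m,u):=\phi(u)_m,\qquad (fu)\rhd_A(gv):=fg\,u\rhd v+f\phi(u)(g)v,$$ for $m\in M$, $u,v\in\mathfrak{g}$, $f,g\in C^\infty(M)$. Then $(M\times\mathfrak{g},[\cdot,\cdot]_{\mathfrak{g}},\rhd_A,a_A)$ is a post-Lie algebroid.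
   Context: A post-Lie algebra $(\mathfrak{g},[\cdot,\cdot]_{\mathfrak{g}},\rhd)$ is a Lie algebra with a bilinear product $\rhd$ such that $u\rhd[v,w]_{\mathfrak{g}}=[u\rhd v,w]_{\mathfrak{g}}+[v,u\rhd w]_{\mathfrak{g}}$ and $[u,v]_{\mathfrak{g}}\rhd w=a_\rhd(u,v,w)-a_\rhd(v,u,w)$, where $a_\rhd(u,v,w):=u\rhd(v\rhd w)-(u\rhd v)\rhd w$. Its subjacent Lie bracket is $\{u,v\}:=[u,v]_{\mathfrak{g}}+u\rhd v-v\rhd u$. An action of the post-Lie algebra on a manifold $M$ is a Lie algebra homomorphism $\phi:(\mathfrak{g},\{\cdot,\cdot\})\to\mathfrak{X}(M)$. A post-Lie algebroid $(A,[\cdot,\cdot]_A,\rhd_A,a_A)$ is a vector bundle $A\to M$ with a $C^\infty(M)$-linear Lie algebra structure $[\cdot,\cdot]_A$ on $\Gamma(A)$, a bilinear operation $\rhd_A$ on $\Gamma(A)$ and a vector bundle morphism $a_A:A\to TM$ such that $(\Gamma(A),[\cdot,\cdot]_A,\rhd_A)$ is a post-Lie algebra and, for all $f\in C^\infty(M)$, $u,v\in\Gamma(A)$: (i) $u\rhd_A(fv)=f(u\rhd_A v)+a_A(u)(f)v$; (ii) $(fu)\rhd_A v=f(u\rhd_A v)$. *)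

(* Defs.v *)
From HB Require Import structures.
From mathcomp Require Import all_boot all_order all_algebra.
From mathcomp Require Import boolp classical_sets functions cardinality reals topology.
From mathcomp Require Import normedtype derive.
From mathcomp Require Import ring.

Set Implicit Arguments.
Unset Strict Implicit.
Unset Printing Implicit Defensive.

Import Order.TTheory GRing.Theory Num.Theory.
Import VectorInternalTheory numFieldNormedType.Exports.

Local Open Scope classical_set_scope.
Local Open Scope ring_scope.

Section Euclidean.
Variables (R : realType) (n : nat).
Implicit Types (D : set 'rV[R]_n) (f g : 'rV[R]_n -> R).

(* Partial derivatives are taken along the standard basis vectors; the
   definition is only meaningful for [D] open. *)
Fixpoint Ck (k : nat) D f : Prop :=
  (forall x, D x -> {for x, continuous f}) /\
  if k is k'.+1 then
    forall i : 'I_n,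
      (forall x, D x -> derivable f x (delta_mx 0 i)) /\
      Ck k' D (fun x => 'D_(delta_mx 0 i) f x)
  else True.

Definition smooth_fun D f := forall k, Ck k D f.

Lemma Ck_ext k D f g : open D -> (forall x, D x -> f x = g x) ->
  Ck k D f -> Ck k D g.
Proof.
move=> oD; have nD x : D x -> \near x, D x by move=> Dx; exact: open_nbhs_nbhs.
elim: k f g => [|k IH] f g fg [cf H]; split=> //.
- move=> x Dx; have nfg : \near x, f x = g x by near do apply: fg; exact: nD.
  move: (cf x Dx); rewrite /prop_for /continuous_at -fg// => h.
  exact: cvg_trans (near_eq_cvg nfg) h.
- move=> x Dx; have nfg : \near x, f x = g x by near do apply: fg; exact: nD.
  move: (cf x Dx); rewrite /prop_for /continuous_at -fg// => h.
  exact: cvg_trans (near_eq_cvg nfg) h.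
move=> i; have [di Hi] := H i; split.
  move=> x Dx; apply: near_eq_derivable (di x Dx).
  by near do apply: fg; exact: nD.
apply: IH Hi => x Dx; apply: near_eq_derive.
by near do apply: fg; exact: nD.
Unshelve. all: by end_near. Qed.

Lemma CkW k D f : Ck k.+1 D f -> Ck k D f.
Proof.
elim: k f => [|k IH] f [cf H]; split=> // i.
by have [di Hi] := H i; split=> //; exact: IH.
Qed.

Lemma Ck_cst k D (c : R) : open D -> Ck k D (cst c).
Proof.
move=> oD; elim: k c => [|k IH] c; split=> //; try by move=> x _; exact: cst_continuous.
move=> i; split=> [x _|]; first exact: derivable_cst.
by apply: Ck_ext (IH 0) => // x _; rewrite derive_cst.
Qed.

Lemma CkD k D f g : open D -> Ck k D f -> Ck k D g -> Ck k D (fun x => f x + g x).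
Proof.
move=> oD; elim: k f g => [|k IH] f g [cf Hf] [cg Hg]; split=> //;
  try by move=> x Dx; exact: (continuousD (cf x Dx) (cg x Dx)).
move=> i; have [df H1] := Hf i; have [dg H2] := Hg i; split=> [x Dx|].
  by apply: derivableD; [exact: df|exact: dg].
apply: Ck_ext (IH _ _ H1 H2) => // x Dx.
by rewrite -deriveD//; [exact: df|exact: dg].
Qed.

Lemma CkM k D f g : open D -> Ck k D f -> Ck k D g -> Ck k D (fun x => f x * g x).
Proof.
move=> oD; elim: k f g => [|k IH] f g [cf Hf] [cg Hg]; split=> //;
  try by move=> x Dx; exact: (continuousM (cf x Dx) (cg x Dx)).
move=> i; have [df H1] := Hf i; have [dg H2] := Hg i; split=> [x Dx|].
  by apply: derivableM; [exact: df|exact: dg].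
have Wf : Ck k D f by apply: CkW.
have Wg : Ck k D g by apply: CkW.
apply: Ck_ext (CkD oD (IH _ _ Wf H2) (IH _ _ Wg H1)) => // x Dx.
by rewrite -[LHS](@deriveM _ _ f g)//; [exact: df|exact: dg].
Qed.

End Euclidean.

Section Manifold.
Variables (R : realType) (n : nat).

(* A homeomorphism from the open set [cdom] onto the open set [ccod]; the values
   of [cmap] and [cinv] elsewhere are irrelevant. *)
Record chart (M : topologicalType) := Chart {
  cdom : set M;
  ccod : set 'rV[R]_n;
  cmap : M -> 'rV[R]_n;
  cinv : 'rV[R]_n -> M;
  cdom_open : open cdom;
  ccod_open : open ccod;
  cmap_in : forall x, cdom x -> ccod (cmap x);
  cinv_in : forall y, ccod y -> cdom (cinv y);
  cmapK : forall x, cdom x -> cinv (cmap x) = x;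
  cinvK : forall y, ccod y -> cmap (cinv y) = y;
  cmap_continuous : forall x, cdom x -> {for x, continuous cmap};
  cinv_continuous : forall y, ccod y -> {for y, continuous cinv} }.

Record manifold := Manifold {
  points :> topologicalType;
  points_hausdorff : hausdorff_space points;
  points_second_countable : @second_countable points;
  atlas : set (chart points);
  atlas_cover : forall x, exists2 c, atlas c & cdom c x;
  atlas_compatible : forall c d, atlas c -> atlas d -> forall i,
    smooth_fun [set y | ccod c y /\ cdom d (cinv c y)]
               (fun y => cmap d (cinv c y) 0 i) }.
Arguments atlas : clear implicits.

Lemma open_chart_image (M : topologicalType) (c : chart M) (U : set M) :
  open U -> open [set y | ccod c y /\ U (cinv c y)].
Proof.
move=> oU; rewrite openE => y [cy Uy]; apply: filterI.
  by apply: open_nbhs_nbhs; split=> //; exact: ccod_open.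
by apply: (cinv_continuous cy); exact: open_nbhs_nbhs.
Qed.

Definition smooth_on (M : manifold) (U : set M) (f : M -> R) :=
  forall c, atlas M c ->
    smooth_fun [set y | ccod c y /\ U (cinv c y)] (f \o cinv c).

End Manifold.
Arguments atlas {R n} _.
Arguments smooth_on {R n} M U f.

Section SmoothFunctions.
Variables (R : realType) (n : nat) (M : manifold R n).
Implicit Types (U V : set M) (f g : M -> R).

Lemma smooth_on_ext U f g : open U -> (forall x, U x -> f x = g x) ->
  smooth_on M U f -> smooth_on M U g.
Proof.
move=> oU fg sf c ac k; apply: Ck_ext (sf c ac k).
  exact: open_chart_image.
by move=> y [_ Uy] /=; exact: fg.
Qed.

Lemma smooth_on_cst U (a : R) : open U -> smooth_on M U (fun=> a).
Proof. by move=> oU c ac k; apply: Ck_cst; exact: open_chart_image. Qed.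

Lemma smooth_onD U f g : open U -> smooth_on M U f -> smooth_on M U g ->
  smooth_on M U (fun x => f x + g x).
Proof.
move=> oU sf sg c ac k; apply: CkD; [exact: open_chart_image|exact: sf|exact: sg].
Qed.

Lemma smooth_onM U f g : open U -> smooth_on M U f -> smooth_on M U g ->
  smooth_on M U (fun x => f x * g x).
Proof.
move=> oU sf sg c ac k; apply: CkM; [exact: open_chart_image|exact: sf|exact: sg].
Qed.

Lemma smooth_onW U V f : V `<=` U -> smooth_on M U f -> smooth_on M V f.
Proof.
move=> VU sf c ac k; move: (sf c ac k).
elim: k (f \o cinv c) => [|k IH] h [ch H]; split=> //;
  try by move=> y [cy Vy]; apply: ch; split=> //; exact: VU.
move=> i; have [d Hi] := H i; split; last exact: IH.
by move=> y [cy Vy]; apply: d; split=> //; exact: VU.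
Qed.

End SmoothFunctions.

Section CinfAlgebra.
Variables (R : realType) (n : nat) (M : manifold R n).

Definition smooth_pred : {pred M -> R^o} := [pred f : M -> R | `[< smooth_on M setT f >]].

Lemma smooth_predP f : reflect (smooth_on M setT f) (f \in smooth_pred).
Proof. exact: asboolP. Qed.

Lemma smooth_subring_closed : subring_closed smooth_pred.
Proof.
split; first by apply/smooth_predP; apply: smooth_on_cst; exact: openT.
- move=> f g /smooth_predP sf /smooth_predP sg; apply/smooth_predP.
  apply: (@smooth_on_ext _ _ _ _ (fun x => f x + (-1) * g x)) => //.
  + exact: openT.
  + by move=> x _; rewrite mulN1r.
  + apply: smooth_onD => //; first exact: openT.
    apply: smooth_onM => //; first exact: openT.
    by apply: smooth_on_cst; exact: openT.
- move=> f g /smooth_predP sf /smooth_predP sg; apply/smooth_predP.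
  by apply: smooth_onM => //; exact: openT.
Qed.

Lemma smooth_submod_closed : submod_closed smooth_pred.
Proof.
split; first by apply/smooth_predP; apply: smooth_on_cst; exact: openT.
move=> a f g /smooth_predP sf /smooth_predP sg; apply/smooth_predP.
apply: (@smooth_onD _ _ _ _ (fun x => a * f x)) => //; first exact: openT.
apply: (@smooth_onM _ _ _ _ (fun=> a) f) => //; first exact: openT.
by apply: smooth_on_cst; exact: openT.
Qed.

Record Cinf := MkCinf { Cinf_val :> M -> R^o; _ : Cinf_val \in smooth_pred }.
HB.instance Definition _ := [isSub for Cinf_val].
HB.instance Definition _ := [Choice of Cinf by <:].
HB.instance Definition _ := 
  GRing.SubChoice_isSubComPzRing.Build _ _ Cinf smooth_subring_closed.
HB.instance Definition _ := 
  GRing.SubZmodule_isSubLmodule.Build R _ _ Cinf 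
    (GRing.submod_closed_semi smooth_submod_closed).

End CinfAlgebra.

(* Dependent functions with pointwise operations. *)
Definition dfun (R : realType) (T : Type) (F : T -> lmodType R) :=
  forall x, F x.
Identity Coercion dfun_to_fun : dfun >-> Funclass.

Section Dfun.
Variables (R : realType) (T : Type) (F : T -> lmodType R).
HB.instance Definition _ := gen_eqMixin (dfun F).
HB.instance Definition _ := gen_choiceMixin (dfun F).

Let add (s t : dfun F) : dfun F := fun x => s x + t x.
Let opp (s : dfun F) : dfun F := fun x => - s x.
Let scale (a : R) (s : dfun F) : dfun F := fun x => a *: s x.

Let addA : associative add.
Proof. by move=> s t u; apply: functional_extensionality_dep => x; exact: addrA. Qed.
Let addC : commutative add.
Proof. by move=> s t; apply: functional_extensionality_dep => x; exact: addrC. Qed.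
Let add0 : left_id (fun=> 0) add.
Proof. by move=> s; apply: functional_extensionality_dep => x; exact: add0r. Qed.
Let addN : left_inverse (fun=> 0) opp add.
Proof. by move=> s; apply: functional_extensionality_dep => x; exact: addNr. Qed.
HB.instance Definition _ := GRing.isZmodule.Build (dfun F) addA addC add0 addN.

Let scaleA a b s : scale a (scale b s) = scale (a * b) s.
Proof. by apply: functional_extensionality_dep => x; exact: scalerA. Qed.
Let scale1 : left_id 1 scale.
Proof. by move=> s; apply: functional_extensionality_dep => x; exact: scale1r. Qed.
Let scaleDr : right_distributive scale +%R.
Proof. by move=> a s t; apply: functional_extensionality_dep => x; exact: scalerDr. Qed.
Let scaleDl s : {morph scale^~ s : a b / a + b}.
Proof. by move=> a b; apply: functional_extensionality_dep => x; exact: scalerDl. Qed.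
HB.instance Definition _ :=
  GRing.Zmodule_isLmodule.Build R (dfun F) scaleA scale1 scaleDr scaleDl.
End Dfun.

(* Tangent vectors at [m] are the derivations of [Cinf M] at [m]. *)
Section Tangent.
Variables (R : realType) (n : nat) (M : manifold R n) (m : M).

Definition point_derivation (D : Cinf M -> R^o) :=
  linear D /\ forall f g : Cinf M, D (f * g) = D f * g m + f m * D g.

Definition point_derivation_pred : {pred Cinf M -> R^o} :=
  [pred D : Cinf M -> R^o | `[< point_derivation D >]].

Lemma point_derivationP D :
  reflect (point_derivation D) (D \in point_derivation_pred).
Proof. exact: asboolP. Qed.

Lemma point_derivation_closed : submod_closed point_derivation_pred.
Proof.
split.
  apply/point_derivationP; split=> [a f g|f g].
    by rewrite -[LHS]/(0 : R) -[RHS]/(a * 0 + 0 : R) mulr0 addr0.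
  by rewrite -[LHS]/(0 : R) -[RHS]/(0 * g m + f m * 0 : R) mulr0 mul0r addr0.
move=> a D E /point_derivationP[lD dD] /point_derivationP[lE dE].
apply/point_derivationP; split=> [b f g|f g].
  rewrite -![(_ + _ : Cinf M -> R^o) _]/(a * D _ + E _) lD lE.
  rewrite -![_ *: _ : R^o]/(_ * _); rewrite !mulrDr !mulrA (mulrC b a) -!addrA.
  by congr (_ + _); rewrite addrCA.
rewrite -![(_ + _ : Cinf M -> R^o) _]/(a * D _ + E _) dD dE.
rewrite mulrDr mulrDl mulrDr !mulrA (mulrC (f m) a) -!addrA; congr (_ + _).
by rewrite addrCA.
Qed.

Record tangent := MkTangent {
  tangent_val :> Cinf M -> R^o;
  _ : tangent_val \in point_derivation_pred }.
HB.instance Definition _ := [isSub for tangent_val].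
HB.instance Definition _ := [Choice of tangent by <:].
HB.instance Definition _ := 
  GRing.SubChoice_isSubLmodule.Build R _ _ tangent
    (GRing.submod_closed_semi point_derivation_closed).
End Tangent.
Arguments tangent {R n} M m.

Section VectorFields.
Variables (R : realType) (n : nat) (M : manifold R n).

(* A family of tangent vectors is smooth when it differentiates every smooth
   function to a smooth function. *)
Definition vector_field_pred : {pred dfun (tangent M)} :=
  [pred X : dfun (tangent M) |
    `[< forall f : Cinf M, smooth_on M setT (fun m => X m f) >]].

Lemma vector_field_predP (X : dfun (tangent M)) :
  reflect (forall f : Cinf M, smooth_on M setT (fun m => X m f))
          (X \in vector_field_pred).
Proof. exact: asboolP. Qed.

Lemma vector_field_closed : submod_closed vector_field_pred.
Proof.
split.
  apply/vector_field_predP => f.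
  by apply: (@smooth_on_cst _ _ _ _ (0 : R)); exact: openT.
move=> a X Y /vector_field_predP sX /vector_field_predP sY.
apply/vector_field_predP => f.
apply: (@smooth_onD _ _ _ _ (fun m => a * X m f)); first exact: openT.
  apply: (@smooth_onM _ _ _ _ (fun=> a)); [exact: openT| |exact: sX].
  by apply: smooth_on_cst; exact: openT.
exact: sY.
Qed.

Record vector_field := MkVectorField {
  vector_field_val :> dfun (tangent M);
  _ : vector_field_val \in vector_field_pred }.
HB.instance Definition _ := [isSub for vector_field_val].
HB.instance Definition _ := [Choice of vector_field by <:].
HB.instance Definition _ := GRing.SubChoice_isSubLmodule.Build R _ _ vector_field
  (GRing.submod_closed_semi vector_field_closed).

Lemma vf_app_subproof (X : vector_field) (f : Cinf M) :
  (fun m => X m f) \in @smooth_pred R n M.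
Proof. by apply/smooth_predP; case: X => X /= /vector_field_predP. Qed.

Definition vf_app (X : vector_field) (f : Cinf M) : Cinf M :=
  MkCinf (vf_app_subproof X f).

Lemma tangent_linear m (D : tangent M m) : linear D.
Proof. by case: D => D /= /point_derivationP[]. Qed.

Lemma tangentM m (D : tangent M m) (f g : Cinf M) :
  D (f * g) = D f * g m + f m * D g.
Proof. by case: D => D /= /point_derivationP[]. Qed.

Lemma CinfP (f g : Cinf M) : (forall m, f m = g m) -> f = g.
Proof. by move=> fg; apply: val_inj; apply/funext. Qed.

Lemma vf_app_linear (X : vector_field) : linear (vf_app X).
Proof. by move=> a f g; apply: CinfP => m; exact: tangent_linear. Qed.

Lemma vf_appM (X : vector_field) (f g : Cinf M) :
  vf_app X (f * g) = vf_app X f * g + f * vf_app X g.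
Proof. by apply: CinfP => m; exact: tangentM. Qed.

Lemma vf_bracket_subproof (X Y : vector_field) (m : M) :
  (fun f => X m (vf_app Y f) - Y m (vf_app X f) : R^o)
    \in @point_derivation_pred R n M m.
Proof.
have tD (D : tangent M m) f g : D (f + g) = D f + D g.
  by have := tangent_linear D 1 f g; rewrite !scale1r.
apply/point_derivationP; split=> [a f g|f g].
  rewrite !vf_app_linear !tangent_linear scalerDr scalerN opprD.
  by rewrite !addrA; congr (_ - _); rewrite addrAC.
rewrite !vf_appM !tD !tangentM /=; ring.
Qed.

Lemma vf_bracket_pt_subproof (X Y : vector_field) :
  (fun m => MkTangent (vf_bracket_subproof X Y m) : tangent M m)
    \in vector_field_pred.
Proof.
apply/vector_field_predP => f /=.
have sm (g : Cinf M) : smooth_on M setT g.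
  by case: g => g /= /smooth_predP.
apply: (@smooth_on_ext _ _ _ _
  (vf_app X (vf_app Y f) - vf_app Y (vf_app X f) : Cinf M)); first exact: openT.
- by [].
- exact: sm.
Qed.

Definition vf_bracket (X Y : vector_field) : vector_field :=
  MkVectorField (vf_bracket_pt_subproof X Y).

End VectorFields.

Section VectorBundles.
Variables (R : realType) (n : nat) (M : manifold R n).

(* A trivialization over the open set [tdom] of a family of vector spaces; the
   values of [tmap] and [tinv] over other points are irrelevant. *)
Record trivialization (k : nat) (F : M -> lmodType R) := Trivialization {
  tdom : set M;
  tmap : forall x, F x -> 'rV[R]_k;
  tinv : forall x, 'rV[R]_k -> F x;
  tdom_open : open tdom;
  tmap_linear : forall x, tdom x -> linear (@tmap x);
  tmapK : forall x, tdom x -> cancel (@tmap x) (@tinv x);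
  tinvK : forall x, tdom x -> cancel (@tinv x) (@tmap x) }.

(* A smooth vector bundle of rank [rank], given by its fibers and by linear
   trivializations with smooth transition functions. *)
Record vector_bundle := VectorBundle {
  fiber :> M -> lmodType R;
  rank : nat;
  trivs : set (trivialization rank fiber);
  trivs_cover : forall x, exists2 t, trivs t & tdom t x;
  trivs_compatible : forall s t, trivs s -> trivs t ->
    forall (v : 'rV[R]_rank) (i : 'I_rank),
      smooth_on M (tdom s `&` tdom t)
        (fun x => tmap t (tinv s x v) 0 i) }.

Section Sections.
Variable E : vector_bundle.

Definition smooth_section (s : dfun E) :=
  forall t, trivs t -> forall i, smooth_on M (tdom t) (fun x => tmap t (s x) 0 i).

Definition section_pred : {pred dfun E} := [pred s : dfun E | `[< smooth_section s >]].

Lemma section_predP (s : dfun E) : reflect (smooth_section s) (s \in section_pred).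
Proof. exact: asboolP. Qed.

Lemma section_closed : submod_closed section_pred.
Proof.
split.
  apply/section_predP => t tE i.
  apply: (@smooth_on_ext _ _ _ _ (fun=> 0)); first exact: tdom_open.
    move=> x tx; have /= := tmap_linear tx (-1) 0 0.
    by rewrite scaleN1r addNr scaleN1r addNr => ->; rewrite mxE.
  by apply: smooth_on_cst; exact: tdom_open.
move=> a u v /section_predP su /section_predP sv.
apply/section_predP => t tE i.
apply: (@smooth_on_ext _ _ _ _
    (fun x => a * tmap t (u x) 0 i + tmap t (v x) 0 i)); first exact: tdom_open.
  by move=> x tx; rewrite [in RHS](tmap_linear tx) !mxE.
apply: smooth_onD; [exact: tdom_open| |exact: sv].
apply: (@smooth_onM _ _ _ _ (fun=> a)); [exact: tdom_open| |exact: su].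
by apply: smooth_on_cst; exact: tdom_open.
Qed.

Record sections := MkSection {
  section_val :> dfun E;
  _ : section_val \in section_pred }.
HB.instance Definition _ := [isSub for section_val].
HB.instance Definition _ := [Choice of sections by <:].
HB.instance Definition _ := GRing.SubChoice_isSubLmodule.Build R _ _ sections
  (GRing.submod_closed_semi section_closed).

Lemma sectionP (s t : sections) : (forall m, s m = t m) -> s = t.
Proof.
by move=> st; apply: val_inj; apply: functional_extensionality_dep.
Qed.

Lemma Cinf_scale_subproof (f : Cinf M) (s : sections) :
  (fun m => f m *: s m) \in section_pred.
Proof.
case: f s => [f /= /smooth_predP sf] [s /= /section_predP ss].
apply/section_predP => t tE i.
apply: (@smooth_on_ext _ _ _ _ (fun x => f x * tmap t (s x) 0 i)).
- exact: tdom_open.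
- move=> x tx; have tl := tmap_linear tx.
  have t0 : tmap t (0 : E x) = 0.
    by have := tl (-1) 0 0; rewrite scaleN1r addNr scaleN1r addNr.
  by rewrite -[f x *: s x]addr0 tl t0 addr0 mxE.
apply: smooth_onM; [exact: tdom_open| |exact: ss].
exact: smooth_onW sf.
Qed.

Definition Cinf_scale (f : Cinf M) (s : sections) : sections :=
  MkSection (Cinf_scale_subproof f s).

Definition Cinf_bilinear (b : sections -> sections -> sections) :=
  [/\ forall s s' t, b (s + s') t = b s t + b s' t,
      forall s t t', b s (t + t') = b s t + b s t',
      forall f s t, b (Cinf_scale f s) t = Cinf_scale f (b s t) &
      forall f s t, b s (Cinf_scale f t) = Cinf_scale f (b s t)].

(* Vector bundle morphisms from [E] to the tangent bundle over the identity of
   [M]. Smoothness is tested on local frames: the image of a frame section must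
   differentiate every smooth function to a smooth function. *)
Definition tangent_morphism (a : forall m, E m -> tangent M m) :=
  (forall m, linear (a m)) /\
  forall t, trivs t -> forall (v : 'rV[R]_(rank E)) (f : Cinf M),
    smooth_on M (tdom t) (fun x => a x (tinv t x v) f).

End Sections.
End VectorBundles.

Notation "f *** s" := (Cinf_scale f s) (at level 40, left associativity) : ring_scope.

Section PostLie.
Variables (R : realType) (V : lmodType R).
Implicit Types (br rhd b : V -> V -> V).

Definition bilinear_op b := bilinear_for *:%R *:%R b.

Record lie_algebra br : Prop := LieAlgebra {
  lie_bilinear : bilinear_op br;
  lie_alternating : forall u, br u u = 0;
  lie_jacobi : forall u v w,
    br u (br v w) + br v (br w u) + br w (br u v) = 0 }.

Definition associator rhd u v w := rhd u (rhd v w) - rhd (rhd u v) w.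

Record post_lie_algebra br rhd : Prop := PostLieAlgebra {
  post_lie_lie : lie_algebra br;
  post_lie_bilinear : bilinear_op rhd;
  post_lie_derivation : forall u v w,
    rhd u (br v w) = br (rhd u v) w + br v (rhd u w);
  post_lie_associator : forall u v w,
    rhd (br u v) w = associator rhd u v w - associator rhd v u w }.

Definition subjacent br rhd u v := br u v + rhd u v - rhd v u.

End PostLie.

Section Actions.
Variables (R : realType) (n : nat) (M : manifold R n).

Record post_lie_action (g : lmodType R) (br rhd : g -> g -> g)
    (phi : g -> vector_field M) : Prop := PostLieAction {
  action_linear : linear phi;
  action_bracket : forall u v,
    phi (subjacent br rhd u v) = vf_bracket (phi u) (phi v) }.

(* The function a_A(u)(f) of the Leibniz rule is [fun m => a m (u m) f]; the rule is
   stated at each point [m]. *)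
Record post_lie_algebroid (E : vector_bundle M)
    (br rhd : sections E -> sections E -> sections E)
    (a : forall m, E m -> tangent M m) : Prop := PostLieAlgebroid {
  algebroid_Cinf_bilinear : Cinf_bilinear br;
  algebroid_anchor : tangent_morphism a;
  algebroid_post_lie : post_lie_algebra br rhd;
  algebroid_leibniz : forall (f : Cinf M) (u v : sections E) m,
    rhd u (f *** v) m = f m *: rhd u v m + a m (u m) f *: v m;
  algebroid_Cinf_linear : forall (f : Cinf M) (u v : sections E),
    rhd (f *** u) v = f *** rhd u v }.

End Actions.

Section TrivialBundle.
Variables (R : realType) (n : nat) (M : manifold R n) (g : vectType R).

Lemma trivial_tmap_linear (x : M) : setT x -> linear (v2r : g -> _).
Proof. by move=> _; exact: linearP. Qed.

Definition global_trivialization : trivialization (dim g) (fun _ : M => g) :=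
  @Trivialization R n M (dim g) (fun=> g) setT (fun=> v2r) (fun=> r2v)
    openT trivial_tmap_linear (fun _ _ => v2rK) (fun _ _ => r2vK).

Lemma trivial_cover (x : M) :
  exists2 t, [set global_trivialization] t & tdom t x.
Proof. by exists global_trivialization. Qed.

Lemma trivial_compatible s t :
    [set global_trivialization] s -> [set global_trivialization] t ->
  forall (v : 'rV[R]_(dim g)) i,
    smooth_on M (tdom s `&` tdom t) (fun x => tmap t (tinv s x v) 0 i).
Proof.
move=> -> -> v i.
exact: (@smooth_on_cst R n M _ (v2r (r2v v : g) 0 i) (openI openT openT)).
Qed.

Definition trivial_bundle : vector_bundle M :=
  VectorBundle trivial_cover trivial_compatible.

Lemma const_section_subproof (u : g) : (fun=> u) \in @section_pred R n M trivial_bundle.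
Proof.
apply/section_predP => t -> i.
exact: (@smooth_on_cst R n M _ (v2r u 0 i) openT).
Qed.

Definition const_section (u : g) : sections trivial_bundle :=
  MkSection (const_section_subproof u).

(* [brA] is the C^oo-bilinear extension of [br] to the sections of [M * g]. *)
Definition bracket_extension (br : g -> g -> g)
    (brA : sections trivial_bundle -> sections trivial_bundle -> sections trivial_bundle) :=
  Cinf_bilinear brA /\
  forall u v, brA (const_section u) (const_section v) = const_section (br u v).

(* [rhdA] is the R-bilinear operation on C^oo(M) (x) g with
   (f u) rhdA (h v) = f h (u rhd v) + f phi(u)(h) v. *)
Definition product_extension (rhd : g -> g -> g) (phi : g -> vector_field M)
    (rhdA : sections trivial_bundle -> sections trivial_bundle -> sections trivial_bundle) :=
  bilinear_op rhdA /\
  forall (f h : Cinf M) (u v : g),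
    rhdA (f *** const_section u) (h *** const_section v) =
    (f * h) *** const_section (rhd u v) + (f * vf_app (phi u) h) *** const_section v.

Definition action_anchor (phi : g -> vector_field M) :
    forall m, trivial_bundle m -> tangent M m :=
  fun m u => phi u m.

End TrivialBundle.

(* Main.v *)
Require Import Defs.
From HB Require Import structures.
From mathcomp Require Import all_boot all_order all_algebra.
From mathcomp Require Import boolp classical_sets functions cardinality reals topology.
From mathcomp Require Import normedtype derive.
From mathcomp Require Import ring.

Set Implicit Arguments.
Unset Strict Implicit.
Unset Printing Implicit Defensive.

Import Order.TTheory GRing.Theory Num.Theory.
Import VectorInternalTheory numFieldNormedType.Exports.

Local Open Scope classical_set_scope.
Local Open Scope ring_scope.

(** The sections of the trivial bundle are the C^oo-combinations of constant
    sections ([frame_decomposition]), which gives uniqueness of both extensions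
    at once. For existence, the bracket is computed fiberwise
    ([tensor_extension]), and the product is the fiberwise product plus the
    derivative of the components of the second argument along the anchor of the
    first ([action_product]). The latter is C^oo-linear in its first argument
    and satisfies the Leibniz rule in the second.

    The remaining axioms hold on constant sections because they hold in the
    post-Lie algebra, so it suffices that the failure of each axiom is a
    C^oo-multilinear expression. For the derivation property this is the Leibniz
    rule ([product_derivation]). For the associator property
    ([product_associator]) it is clear in the first two arguments, while in the
    third a coefficient [f] contributes the difference between the derivative of
    [f] along the subjacent bracket of two sections and the commutator of the
    derivatives along them. This difference vanishes because the anchor is a
    homomorphism for the subjacent bracket of sections ([derivative_bracket]);
    that too is tensorial, and on constant sections it says that [phi] is an
    action. *)

(** * Tangent vectors and bilinear operations *)

Section SmoothAlgebra.
Variables (R : realType) (n : nat) (M : manifold R n).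

Lemma tangentD m (D : tangent M m) : {morph D : f g / f + g}.
Proof. by move=> f g; have := tangent_linear D 1 f g; rewrite !scale1r. Qed.

(** Leibniz at [1 * 1] gives [D 1 = D 1 + D 1]. *)
Lemma tangent_cst m (D : tangent M m) (a : R) : D (a *: (1 : Cinf M)) = 0.
Proof.
have D1 : D 1 = 0.
  have := tangentM D 1 1.
  rewrite mulr1 -[(1 : Cinf M) m]/(1 : R) mulr1 mul1r.
  by move/eqP; rewrite -subr_eq0 opprD addNKr oppr_eq0 => /eqP.
have D0 : D 0 = 0 by apply: (@addrI _ (D 0)); rewrite -tangentD !addr0.
by rewrite -[a *: (1 : Cinf M)]addr0 tangent_linear D1 D0 scaler0 addr0.
Qed.

End SmoothAlgebra.

Section BilinearOp.
Variables (R : realType) (V : lmodType R) (b : V -> V -> V).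
Hypothesis bL : bilinear_op b.

Let linl w a u v : b (a *: u + v) w = a *: b u w + b v w.
Proof. by case: bL => /(_ w a u v). Qed.

Let linr u a v w : b u (a *: v + w) = a *: b u v + b u w.
Proof. by case: bL => _ /(_ u a v w). Qed.

Lemma bilinear_opDl u v w : b (u + v) w = b u w + b v w.
Proof. by rewrite -{1}[u]scale1r linl scale1r. Qed.

Lemma bilinear_opDr u v w : b u (v + w) = b u v + b u w.
Proof. by rewrite -{1}[v]scale1r linr scale1r. Qed.

Lemma bilinear_opZl a u w : b (a *: u) w = a *: b u w.
Proof.
have b0 : b 0 w = 0.
  by apply: (@addIr _ (b 0 w)); rewrite -bilinear_opDl !add0r.
by rewrite -[a *: u]addr0 linl b0 addr0.
Qed.

Lemma bilinear_opZr a u w : b u (a *: w) = a *: b u w.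
Proof.
have b0 : b u 0 = 0.
  by apply: (@addIr _ (b u 0)); rewrite -bilinear_opDr !add0r.
by rewrite -[a *: w]addr0 linr b0 addr0.
Qed.

End BilinearOp.

(** * Sections of the trivial bundle *)

Section TrivialSections.
Variables (R : realType) (n : nat) (M : manifold R n) (g : vectType R).
Local Notation S := (sections (trivial_bundle M g)).
Implicit Types (s t u v w : S) (f h : Cinf M) (m : M).

Lemma component_subproof s (j : 'I_(dim g)) :
  (fun m => v2r (s m : g) 0 j) \in @smooth_pred R n M.
Proof.
case: s => s /= /section_predP ss.
by apply/smooth_predP; exact: (ss (global_trivialization M g) erefl j).
Qed.

(** Equalities of sections are checked on components, where they become
    identities in the commutative ring of smooth functions. *)
Definition component s j : Cinf M := MkCinf (component_subproof s j).

Lemma componentP s t : (forall j, component s j = component t j) -> s = t.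
Proof.
move=> st; apply: sectionP => m; apply: (@v2r_inj _ g); apply/rowP => j.
exact: (congr1 (fun f : Cinf M => f m) (st j)).
Qed.

Let row_entry (x y : 'rV[R]_(dim g)) (j : 'I_(dim g)) : x = y -> x 0 j = y 0 j.
Proof. by move->. Qed.

Lemma componentD s t j : component (s + t) j = component s j + component t j.
Proof.
apply: CinfP => m.
by have /row_entry-/(_ j) := linearD (@v2r R g) (s m) (t m); rewrite mxE.
Qed.

Lemma componentN s j : component (- s) j = - component s j.
Proof.
apply: CinfP => m.
by have /row_entry-/(_ j) := linearN (@v2r R g) (s m); rewrite mxE.
Qed.

Lemma componentZ f s j : component (f *** s) j = f * component s j.
Proof.
apply: CinfP => m.
by have /row_entry-/(_ j) := linearZ_LR (@v2r R g) (f m) (s m); rewrite mxE.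
Qed.

Definition componentE := (componentD, componentN, componentZ).

Definition frame (j : 'I_(dim g)) : S := const_section M (r2v (delta_mx 0 j) : g).

Lemma section_sumE I (r : seq I) (F : I -> S) m :
  ((\sum_(i <- r) F i : S) m : g) = \sum_(i <- r) (F i m : g).
Proof. exact: (big_morph (fun s : S => s m : g)). Qed.

Lemma frame_decomposition s : s = \sum_j component s j *** frame j.
Proof.
apply: sectionP => m; rewrite section_sumE.
rewrite -{1}[s m](@v2rK _ g) [v2r _]row_sum_delta linear_sum.
by apply: eq_bigr => j _; rewrite linearZ.
Qed.

(** Sections are the C^oo-span of the constant frame. This form serves for
    operations only known to be additive, whose values on the decomposable
    sections [f *** x] are prescribed. *)
Lemma section_generator_ind (P : S -> Prop) :
    (forall s t, P s -> P t -> P (s + t)) ->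
    (forall f (x : g), P (f *** const_section M x)) ->
  forall s, P s.
Proof.
move=> PD PZ s; rewrite (frame_decomposition s).
apply: (big_ind P) => [|//|j _]; last exact: PZ.
have -> : 0 = 0 *** const_section M (0 : g).
  by apply: sectionP => m; apply/esym/scale0r.
exact: PZ.
Qed.

(** Reduction of tensorial identities to constant sections. *)
Lemma section_ind (P : S -> Prop) :
    (forall s t, P s -> P t -> P (s + t)) ->
    (forall f s, P s -> P (f *** s)) ->
    (forall x : g, P (const_section M x)) ->
  forall s, P s.
Proof. by move=> PD PZ Pc; apply: section_generator_ind => // f x; exact: PZ. Qed.

Lemma Cinf_scaler0 f : f *** 0 = 0 :> S.
Proof. by apply: sectionP => m; exact: scaler0. Qed.

(** Turns C^oo-linearity, or the Leibniz rule, into linearity over the reals. *)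
Lemma scale_CinfE (a : R) s : a *: s = (a *: (1 : Cinf M)) *** s.
Proof.
apply: sectionP => m; congr (_ *: (s m : g)).
by rewrite -[RHS]/(a * 1) mulr1.
Qed.

Lemma component_frame_sum (F : 'I_(dim g) -> Cinf M) j :
  component (\sum_k F k *** frame k) j = F j.
Proof.
apply: CinfP => m; rewrite /= section_sumE.
have -> : \sum_k (F k *** frame k) m = r2v (\row_k F k m) :> g.
  rewrite [\row_k _]row_sum_delta linear_sum; apply: eq_bigr => k _.
  by rewrite linearZ mxE.
by rewrite r2vK mxE.
Qed.

Lemma Cinf_bilinear_eq (B C : S -> S -> S) :
    Cinf_bilinear B -> Cinf_bilinear C ->
    (forall x y : g, B (const_section M x) (const_section M y) =
                     C (const_section M x) (const_section M y)) ->
  B = C.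
Proof.
move=> [BDl BDr BZl BZr] [CDl CDr CZl CZr] BC.
apply/funext => s; apply/funext => t.
elim/section_ind: s => [s s' Es Es'|f s Es|x].
- by rewrite BDl CDl Es Es'.
- by rewrite BZl CZl Es.
elim/section_ind: t => [t t' Et Et'|f t Et|y]; last exact: BC.
- by rewrite BDr CDr Et Et'.
- by rewrite BZr CZr Et.
Qed.

Lemma Cinf_bilinear_op (B : S -> S -> S) : Cinf_bilinear B -> bilinear_op B.
Proof.
move=> [BDl BDr BZl BZr]; split=> [w a u v|u a v w] /=.
- by rewrite BDl scale_CinfE BZl -scale_CinfE.
- by rewrite BDr scale_CinfE BZr -scale_CinfE.
Qed.

(** * Extension of the Lie bracket *)

Section Extension.
Variable b : g -> g -> g.
Hypothesis bL : bilinear_op b.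

(** By bilinearity the smoothness of the fiberwise value reduces to decomposable
    sections [f *** x] and [h *** y], where it is [(f * h) *** b x y]. *)
Lemma tensor_subproof s t :
  (fun m => b (s m) (t m)) \in @section_pred _ _ _ (trivial_bundle M g).
Proof.
suff [r rE] : exists r : S, forall m, r m = b (s m) (t m) :> g.
  have -> : (fun m => b (s m) (t m)) = section_val r.
    by apply: functional_extensionality_dep => m; rewrite rE.
  exact: valP.
elim/section_generator_ind: s => [s s' [r rE] [r' rE']|f x].
  by exists (r + r') => m; rewrite bilinear_opDl// -rE -rE'.
elim/section_generator_ind: t => [t t' [r rE] [r' rE']|h y].
  by exists (r + r') => m; rewrite bilinear_opDr// -rE -rE'.
exists ((f * h) *** const_section M (b x y)) => m.
by rewrite bilinear_opZl// bilinear_opZr// scalerA.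
Qed.

Definition tensor_extension s t : S := MkSection (tensor_subproof s t).

Lemma tensor_extensionP : bracket_extension b tensor_extension.
Proof.
split; last by move=> u v; apply: sectionP.
split=> [s s' t|s t t'|f s t|f s t]; apply: sectionP => m.
- exact: (bilinear_opDl bL).
- exact: (bilinear_opDr bL).
- exact: (bilinear_opZl bL).
- exact: (bilinear_opZr bL).
Qed.

Lemma bracket_extension_unique brA :
  bracket_extension b brA -> tensor_extension = brA.
Proof.
have [eL ec] := tensor_extensionP; move=> [bAL bc].
by apply: Cinf_bilinear_eq => // x y; rewrite ec bc.
Qed.

End Extension.

(** * The product defined by the action *)

Section ActionProduct.
Variables (br rhd : g -> g -> g) (phi : g -> vector_field M).
Hypotheses (hg : post_lie_algebra br rhd) (hphi : post_lie_action br rhd phi).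

Local Notation c := (const_section M).

Let brL : bilinear_op br := lie_bilinear (post_lie_lie hg).
Let rhdL : bilinear_op rhd := post_lie_bilinear hg.

Lemma actionD (x y : g) m h : phi (x + y) m h = phi x m h + phi y m h.
Proof. by have := action_linear hphi 1 x y; rewrite !scale1r => ->. Qed.

Lemma actionZ a (x : g) m h : phi (a *: x) m h = a * phi x m h.
Proof.
have phi0 : phi 0 = 0.
  have := action_linear hphi 1 0 0; rewrite !scale1r addr0 => /eqP.
  by rewrite -subr_eq0 opprD addNKr oppr_eq0 => /eqP.
by have := action_linear hphi a x 0; rewrite phi0 !addr0 => ->.
Qed.

Lemma derivative_subproof s h :
  (fun m => phi (s m) m h) \in @smooth_pred R n M.
Proof.
suff [r rE] : exists r : Cinf M, forall m, r m = phi (s m) m h.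
  by have -> : (fun m => phi (s m) m h) = Cinf_val r;
    [apply/funext => m; rewrite rE|exact: valP].
elim/section_generator_ind: s => [s s' [r rE] [r' rE']|f x].
  by exists (r + r') => m; rewrite actionD -rE -rE'.
by exists (f * vf_app (phi x) h) => m; rewrite actionZ.
Qed.

(** The derivative of a function along the vector field which is the image of a
    section under the anchor. *)
Definition derivative s h : Cinf M := MkCinf (derivative_subproof s h).

Lemma derivativeDl s t h : derivative (s + t) h = derivative s h + derivative t h.
Proof. by apply: CinfP => m; exact: actionD. Qed.

Lemma derivativeZl f s h : derivative (f *** s) h = f * derivative s h.
Proof. by apply: CinfP => m; exact: actionZ. Qed.

Lemma derivativeNl s h : derivative (- s) h = - derivative s h.
Proof.
have -> : - s = (-1) *** s by apply: componentP => j; rewrite !componentE; ring.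
by rewrite derivativeZl; ring.
Qed.

Lemma derivative_const x h : derivative (c x) h = vf_app (phi x) h.
Proof. exact: CinfP. Qed.

Lemma derivativeDr s f h : derivative s (f + h) = derivative s f + derivative s h.
Proof. by apply: CinfP => m; exact: tangentD. Qed.

Lemma derivativeM s f h :
  derivative s (f * h) = derivative s f * h + f * derivative s h.
Proof. by apply: CinfP => m; exact: tangentM. Qed.

Lemma derivative_cst s (a : R) : derivative s (a *: (1 : Cinf M)) = 0.
Proof. by apply: CinfP => m; exact: tangent_cst. Qed.

Lemma component_const (x : g) j : component (c x) j = v2r x 0 j *: (1 : Cinf M).
Proof. by apply: CinfP => m; rewrite -[RHS]/(v2r x 0 j * 1) mulr1. Qed.

(** The flat connection of the trivial bundle, for which the constant sections
    are parallel, pulled back along the anchor. *)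
Definition flat_derivative s t : S := \sum_j derivative s (component t j) *** frame j.

(** A closed form of the product: the tensorial part carries [rhd], and the
    connection carries the derivatives of coefficients. It is locked so that
    rewriting with the additivity of components does not split a product into
    these two summands. *)
Definition action_product : S -> S -> S :=
  locked (fun s t => tensor_extension rhdL s t + flat_derivative s t).

Definition action_bracketA := tensor_extension brL.

Local Notation "s |> t" := (action_product s t) (at level 40).
Local Notation "{[ s , t ]}" := (action_bracketA s t).

Lemma component_product s t j :
  component (s |> t) j = component (tensor_extension rhdL s t) j + derivative s (component t j).
Proof. by rewrite /action_product -lock componentD component_frame_sum. Qed.

Let tensor_rhdL : Cinf_bilinear (tensor_extension rhdL).
Proof. by case: (tensor_extensionP rhdL). Qed.

Lemma productDl s t u : (s + t) |> u = s |> u + t |> u.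
Proof.
have [tDl _ _ _] := tensor_rhdL.
by apply: componentP => j; rewrite componentE !component_product tDl componentE derivativeDl; ring.
Qed.

Lemma productDr s t u : s |> (t + u) = s |> t + s |> u.
Proof.
have [_ tDr _ _] := tensor_rhdL.
by apply: componentP => j; rewrite componentE !component_product tDr !componentE derivativeDr; ring.
Qed.

Lemma productZl f s t : (f *** s) |> t = f *** (s |> t).
Proof.
have [_ _ tZl _] := tensor_rhdL.
by apply: componentP => j; rewrite componentE !component_product tZl componentE derivativeZl; ring.
Qed.

Lemma product_leibniz f s t :
  s |> (f *** t) = f *** (s |> t) + derivative s f *** t.
Proof.
have [_ _ _ tZr] := tensor_rhdL.
apply: componentP => j; rewrite !componentE !component_product tZr !componentE derivativeM; ring.
Qed.

Lemma product_const (x y : g) : c x |> c y = c (rhd x y).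
Proof.
have [_ tc] := tensor_extensionP rhdL.
by apply: componentP => j; rewrite component_product tc [component (c y) j]component_const
  derivative_cst addr0.
Qed.

Lemma productNl s t : (- s) |> t = - (s |> t).
Proof.
have E u : - u = (-1) *** u by apply: componentP => j; rewrite !componentE; ring.
by rewrite E productZl -E.
Qed.

Lemma action_product_bilinear : bilinear_op action_product.
Proof.
split=> [w a u v|u a v w] /=.
- by rewrite productDl scale_CinfE productZl -scale_CinfE.
- rewrite productDr !scale_CinfE product_leibniz derivative_cst.
  by congr (_ + _); apply: componentP => j; rewrite !componentE mul0r addr0.
Qed.

Lemma action_productP : product_extension rhd phi action_product.
Proof.
split; first exact: action_product_bilinear.
move=> f h x y; rewrite productZl product_leibniz product_const derivative_const.
by apply: componentP => j; rewrite !componentE; ring.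
Qed.

(** Decomposable sections generate additively, so biadditivity and the
    prescribed values leave no choice. *)
Lemma product_extension_unique rhdA :
  product_extension rhd phi rhdA -> action_product = rhdA.
Proof.
have [pL pE] := action_productP; move=> [rL rE].
apply/funext => s; apply/funext => t.
elim/section_generator_ind: s => [s s' Es Es'|f x].
  by rewrite productDl (bilinear_opDl rL) Es Es'.
elim/section_generator_ind: t => [t t' Et Et'|h y].
  by rewrite productDr (bilinear_opDr rL) Et Et'.
by rewrite pE rE.
Qed.

Let bracket_bilinear : Cinf_bilinear action_bracketA.
Proof. by case: (tensor_extensionP brL). Qed.

Let bDl s t u : {[s + t, u]} = {[s, u]} + {[t, u]}.
Proof. by case: bracket_bilinear. Qed.
Let bDr s t u : {[s, t + u]} = {[s, t]} + {[s, u]}.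
Proof. by case: bracket_bilinear. Qed.
Let bZl f s t : {[f *** s, t]} = f *** {[s, t]}.
Proof. by case: bracket_bilinear. Qed.
Let bZr f s t : {[s, f *** t]} = f *** {[s, t]}.
Proof. by case: bracket_bilinear. Qed.
Let bc x y : {[c x, c y]} = c (br x y).
Proof. by case: (tensor_extensionP brL). Qed.

(** * Compatibility with the post-Lie structure *)

(** The bracket is computed fiberwise, and each fiber is the given Lie algebra. *)
Lemma bracket_lie_algebra : lie_algebra action_bracketA.
Proof.
have [[_ brA brJ] _ _ _] := hg.
split; first exact: Cinf_bilinear_op.
- by move=> u; apply: sectionP => m; exact: brA.
- by move=> u v w; apply: sectionP => m; exact: brJ.
Qed.

Lemma bracket_antisym u v : {[u, v]} = - {[v, u]}.
Proof.
have [_ alt _] := bracket_lie_algebra.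
apply/eqP; rewrite -addr_eq0; apply/eqP.
by have := alt (u + v); rewrite bDl !bDr !alt add0r addr0.
Qed.

(** The homomorphism property of the anchor for the subjacent bracket of
    sections, solved for one term so as to serve as a rewriting rule. The defect [A] is
    antisymmetric, and C^oo-linear in its first argument: for [f *** s] the term
    [derivative t f * derivative s h] arises both from
    [derivative t (derivative (f *** s) h)] and from
    [derivative (t |> (f *** s)) h], and cancels. On constant sections the defect
    vanishes because [phi] is a homomorphism. *)
Lemma derivative_bracket u v h :
  derivative {[u, v]} h =
    derivative u (derivative v h) - derivative v (derivative u h)
    - derivative (u |> v) h + derivative (v |> u) h.
Proof.
pose A s t := derivative {[s, t]} h - (derivative s (derivative t h)
  - derivative t (derivative s h) - derivative (s |> t) h + derivative (t |> s) h).
suff A0 : A u v = 0 by move/eqP: A0; rewrite subr_eq0 => /eqP.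
have AN s t : A s t = - A t s.
  by rewrite /A bracket_antisym derivativeNl; ring.
have AD s s' t : A (s + s') t = A s t + A s' t.
  rewrite /A bDl productDl productDr !derivativeDl derivativeDr; ring.
have AZ f s t : A (f *** s) t = f * A s t.
  rewrite /A bZl productZl product_leibniz !derivativeDl !derivativeZl derivativeM.
  ring.
elim/section_ind: u => [s s' E E'|f s E|x]; first by rewrite AD E E' addr0.
  by rewrite AZ E mulr0.
rewrite AN; elim/section_ind: v => [s s' E E'|f s E|y].
- by rewrite AD opprD E E' addr0.
- by rewrite AZ -mulrN E mulr0.
rewrite -AN /A !product_const bc.
have -> : derivative (c x) (derivative (c y) h) - derivative (c y) (derivative (c x) h)
    = derivative (c (subjacent br rhd x y)) h.
  rewrite !derivative_const (action_bracket hphi); exact: CinfP.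
rewrite /subjacent.
have -> : c (br x y + rhd x y - rhd y x) = c (br x y) + c (rhd x y) - c (rhd y x).
  exact: sectionP.
rewrite !derivativeDl derivativeNl; ring.
Qed.

(** The defect [D] is C^oo-linear in each argument: a coefficient pulled out of
    [v] or [w] is differentiated once on each side, and these terms agree as the
    bracket is C^oo-bilinear. *)
Lemma product_derivation u v w :
  u |> {[v, w]} = {[u |> v, w]} + {[v, u |> w]}.
Proof.
pose D s t r := s |> {[t, r]} - ({[s |> t, r]} + {[t, s |> r]}).
suff D0 : D u v w = 0 by move/eqP: D0; rewrite subr_eq0 => /eqP.
elim/section_ind: u => [s s' E E'|f s E|x].
- have -> : D (s + s') v w = D s v w + D s' v w.
    rewrite /D !productDl bDl bDr.
    by apply: componentP => j; rewrite !componentE; ring.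
  by rewrite E E' addr0.
- have -> : D (f *** s) v w = f *** D s v w.
    rewrite /D !productZl bZl bZr.
    by apply: componentP => j; rewrite !componentE; ring.
  by rewrite E Cinf_scaler0.
elim/section_ind: v => [s s' E E'|f s E|y].
- have -> : D (c x) (s + s') w = D (c x) s w + D (c x) s' w.
    rewrite /D productDr !bDl productDr.
    by apply: componentP => j; rewrite !componentE; ring.
  by rewrite E E' addr0.
- have -> : D (c x) (f *** s) w = f *** D (c x) s w.
    rewrite /D product_leibniz !bZl product_leibniz bDl !bZl.
    by apply: componentP => j; rewrite !componentE; ring.
  by rewrite E Cinf_scaler0.
elim/section_ind: w => [s s' E E'|f s E|z].
- have -> : D (c x) (c y) (s + s') = D (c x) (c y) s + D (c x) (c y) s'.
    rewrite /D !bDr !productDr !bDr.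
    by apply: componentP => j; rewrite !componentE; ring.
  by rewrite E E' addr0.
- have -> : D (c x) (c y) (f *** s) = f *** D (c x) (c y) s.
    rewrite /D !bZr !product_leibniz bDr !bZr.
    by apply: componentP => j; rewrite !componentE; ring.
  by rewrite E Cinf_scaler0.
rewrite /D !bc !product_const !bc (post_lie_derivation hg).
by apply/eqP; rewrite subr_eq0; apply/eqP; exact: sectionP.
Qed.

(** The defect [T] is antisymmetric in its first two arguments, and linear over
    smooth functions in the first, since the associator itself is linear over
    smooth functions in both: the term [derivative v f *** (u |> w)] occurs in
    [v |> ((f *** u) |> w)] and in [(v |> (f *** u)) |> w]. A coefficient [f] of the
    third argument leaves that argument multiplied by the value at [f] of the
    defect of the anchor as a homomorphism, which is zero by
    [derivative_bracket]. *)
Lemma product_associator u v w :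
  {[u, v]} |> w = associator action_product u v w - associator action_product v u w.
Proof.
pose T s t r := {[s, t]} |> r
  - (associator action_product s t r - associator action_product t s r).
suff T0 : T u v w = 0 by move/eqP: T0; rewrite subr_eq0 => /eqP.
have TN s t r : T s t r = - T t s r.
  rewrite /T bracket_antisym productNl.
  by apply: componentP => j; rewrite !componentE; ring.
have TD s s' t r : T (s + s') t r = T s t r + T s' t r.
  rewrite /T /associator bDl !(productDl, productDr).
  by apply: componentP => j; rewrite !componentE; ring.
have TZ f s t r : T (f *** s) t r = f *** T s t r.
  rewrite /T /associator bZl !(productZl, product_leibniz, productDl).
  by apply: componentP => j; rewrite !componentE; ring.
elim/section_ind: u => [s s' E E'|f s E|x]; first by rewrite TD E E' addr0.
  by rewrite TZ E Cinf_scaler0.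
elim/section_ind: v => [s s' E E'|f s E|y].
- by rewrite TN TD opprD -!TN E E' addr0.
- rewrite TN TZ; have -> : T s (c x) w = 0 by rewrite TN E oppr0.
  by rewrite Cinf_scaler0 oppr0.
elim/section_ind: w => [s s' E E'|f s E|z].
- have -> : T (c x) (c y) (s + s') = T (c x) (c y) s + T (c x) (c y) s'.
    rewrite /T /associator !productDr.
    by apply: componentP => j; rewrite !componentE; ring.
  by rewrite E E' addr0.
- have -> : T (c x) (c y) (f *** s) = f *** T (c x) (c y) s.
    (* The mixed terms [derivative x f *** (y |> s)] cancel by symmetry. *)
    rewrite /T /associator !(product_leibniz, productDr).
    by apply: componentP => j; rewrite !componentE derivative_bracket; ring.
  by rewrite E Cinf_scaler0.
rewrite /T /associator !bc !product_const (post_lie_associator hg).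
by apply/eqP; rewrite subr_eq0; apply/eqP; exact: sectionP.
Qed.

Lemma action_anchor_morphism :
  tangent_morphism (E := trivial_bundle M g) (action_anchor (M := M) phi).
Proof.
split=> [m a x y|t -> x h] /=.
  by apply: val_inj; apply/funext => h; apply: etrans (actionD _ _ m h) _;
    rewrite actionZ.
exact/smooth_predP/(vf_app_subproof (phi (r2v (x : 'rV_(dim g)) : g))).
Qed.

Lemma action_algebroid :
  post_lie_algebroid action_bracketA action_product (action_anchor phi).
Proof.
split.
- exact: bracket_bilinear.
- exact: action_anchor_morphism.
- split.
  + exact: bracket_lie_algebra.
  + exact: action_product_bilinear.
  + exact: product_derivation.
  + exact: product_associator.
- by move=> f u v m; rewrite product_leibniz.
- exact: productZl.
Qed.

End ActionProduct.

End TrivialSections.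

Theorem proposition4p19 (R : realType) (n : nat) (M : manifold R n)
    (g : vectType R) (br rhd : g -> g -> g) (hg : post_lie_algebra br rhd)
    (phi : g -> vector_field M) (hphi : post_lie_action br rhd phi) :
  (exists! brA, bracket_extension (M := M) br brA) /\
  (exists! rhdA, product_extension rhd phi rhdA) /\
  forall brA rhdA : sections (trivial_bundle M g) -> sections (trivial_bundle M g) ->
      sections (trivial_bundle M g),
    bracket_extension br brA -> product_extension rhd phi rhdA ->
    post_lie_algebroid brA rhdA (action_anchor phi).
Proof.
have brL : bilinear_op br by case: hg => -[].
split; first by exists (tensor_extension brL); split;
  [exact: tensor_extensionP|exact: bracket_extension_unique].
split; first by exists (action_product hg hphi); split;
  [exact: action_productP|exact: product_extension_unique].
move=> brA rhdA hb hr.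
rewrite -(product_extension_unique hg hphi hr).
rewrite -(bracket_extension_unique (lie_bilinear (post_lie_lie hg)) hb).
exact: action_algebroid.
Qed.
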